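(* Let $f:\mathbb{R}^d\to\mathbb{R}$ be a differentiable concavifiable function with a concavifier $\alpha>0$. Let $0<\eta\le 1/\alpha$, and let $(\bm{x_t})_{t\ge 0}$ be generated by gradient descent with fixed step size $\eta$ from an arbitrary starting point. Then for every time step $t$, $$f(\bm{x_{t+1}})\le f(\bm{x_t})-\frac{\eta}{2}\|\nabla f(\bm{x_t})\|^2 .$$ Moreover, the optimal step size is $\eta^*=1/\alpha^*$, where $\alpha^*$ is the optimal (lowest possible) concavifier of $f$.
   Context: $\|\cdot\|$ is the Euclidean norm on $\mathbb{R}^d$. A function $f:\mathbb{R}^d\to\mathbb{R}$ is concavifiable with concavifier $\alpha>0$ if $g(\bm{x})=\frac{\alpha}{2}\|\bm{x}\|^2-f(\bm{x})$ is convex on $\mathbb{R}^d$. The optimal concavifier $\alpha^*$ is the least $\alpha>0$ for which $g$ is convex. Gradient descent with fixed step size $\eta$ is the iteration $\bm{x_{t+1}}=\bm{x_t}-\eta\nabla f(\bm{x_t})$. Meaning of ''optimal step size'': for a concavifier $\alpha$, the decrease in one gradient descent step with step size $\eta$ is guaranteed to be $f(\bm{x_t})-f(\bm{x_{t+1}})\ge \left(1-\frac{\alpha\eta}{2}\right)\eta\,\|\nabla f(\bm{x_t})\|^2$. The optimal step size is the $\eta$ which maximizes the coefficient $\left(1-\frac{\alpha\eta}{2}\right)\eta$ of this guaranteed decrease, jointly over step sizes $\eta>0$ and concavifiers $\alpha$ of $f$. *)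

(* Defs.v *)
From HB Require Import structures.
From mathcomp Require Import all_boot all_order all_algebra.
From mathcomp Require Import all_classical all_reals all_analysis.

Set Implicit Arguments.
Unset Strict Implicit.
Unset Printing Implicit Defensive.

Import Order.TTheory GRing.Theory Num.Theory.
Import numFieldNormedType.Exports.

Local Open Scope classical_set_scope.
Local Open Scope ring_scope.

(* The canonical norm on 'rV[R]_d is the sup norm. It induces the same topology,
   hence the same notion of differentiability, but the theorem is about the
   Euclidean norm. *)
Definition enorm (R : realType) (d : nat) (v : 'rV[R]_d) : R :=
  Num.sqrt (\sum_(i < d) v 0 i ^+ 2).

Definition gradient (R : realType) (d : nat) (f : 'rV[R]_d -> R)
    (x : 'rV[R]_d) : 'rV[R]_d :=
  \row_(i < d) 'D_(delta_mx 0 i) f x.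

Definition concavifier (R : realType) (d : nat) (f : 'rV[R]_d -> R)
    (alpha : R) : Prop :=
  0 < alpha /\
  @convex_function R 'rV[R]_d setT
    (fun x : 'rV[R]_d => alpha / 2 * enorm x ^+ 2 - f x).

(* A least concavifier need not exist: every alpha > 0 concavifies a concave f. *)
Definition optimal_concavifier (R : realType) (d : nat) (f : 'rV[R]_d -> R)
    (astar : R) : Prop :=
  concavifier f astar /\ lbound [set alpha | concavifier f alpha] astar.

Definition gradient_descent (R : realType) (d : nat) (f : 'rV[R]_d -> R)
    (eta : R) (x : nat -> 'rV[R]_d) : Prop :=
  forall t : nat, x t.+1 = x t - eta *: gradient f (x t).

(* For a concavifier alpha, a gradient descent step of size eta is guaranteed to
   decrease f by at least this coefficient times enorm (gradient f x) ^+ 2. *)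
Definition decrease_coef (R : realType) (alpha eta : R) : R :=
  (1 - alpha * eta / 2) * eta.

(* The maximum is taken jointly over step sizes and concavifiers. *)
Definition optimal_step_size (R : realType) (d : nat) (f : 'rV[R]_d -> R)
    (eta : R) : Prop :=
  0 < eta /\
  exists2 alpha : R, concavifier f alpha &
    forall eta' alpha' : R, 0 < eta' -> concavifier f alpha' ->
      decrease_coef alpha' eta' <= decrease_coef alpha eta.

(* Main.v *)
(* Along a ray x + t h, convexity of alpha/2 |.|^2 - f bounds f (x + h) - f x by
   the difference quotient (f (x + t h) - f x) / t plus alpha/2 |h|^2 for every
   t in ]0, 1[. Letting t tend to 0 gives the quadratic upper bound
   f (x + h) <= f x + D_h f x + alpha/2 |h|^2, which for h = - eta grad f x is
   the guaranteed decrease with coefficient (1 - alpha eta / 2) eta.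
   This coefficient equals 1/(2 alpha) - alpha/2 (eta - 1/alpha)^2 and is
   nonincreasing in alpha, so its joint maximum is reached only at
   eta = 1/alpha for the least alpha. *)
Require Import Defs.
From HB Require Import structures.
From mathcomp Require Import all_boot all_order all_algebra.
From mathcomp Require Import all_classical all_reals all_analysis.
From mathcomp Require Import ring lra.

Set Implicit Arguments.
Unset Strict Implicit.
Unset Printing Implicit Defensive.

Import Order.TTheory GRing.Theory Num.Theory.
Import numFieldNormedType.Exports.

Local Open Scope ring_scope.

Lemma enorm_sqr (R : realType) (d : nat) (v : 'rV[R]_d) :
  enorm v ^+ 2 = \sum_(i < d) v 0 i ^+ 2.
Proof. by rewrite sqr_sqrtr// sumr_ge0// => i _; exact: sqr_ge0. Qed.

Lemma enorm_sqrZ (R : realType) (d : nat) (a : R) (v : 'rV[R]_d) :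
  enorm (a *: v) ^+ 2 = a ^+ 2 * enorm v ^+ 2.
Proof.
rewrite !enorm_sqr mulr_sumr; apply: eq_bigr => i _.
by rewrite mxE exprMn.
Qed.

(** The exact convexity defect of the squared norm; its term [t * (1 - t)] is what leaves
    [alpha / 2 * enorm h ^+ 2] after division by [t]. *)
Lemma enorm_sqrDZ (R : realType) (d : nat) (t : R) (x h : 'rV[R]_d) :
  enorm (x + t *: h) ^+ 2 =
  (1 - t) * enorm x ^+ 2 + t * enorm (x + h) ^+ 2 - t * (1 - t) * enorm h ^+ 2.
Proof.
rewrite !enorm_sqr !mulr_sumr -big_split /= -sumrB; apply: eq_bigr => i _.
by rewrite !mxE; ring.
Qed.

Lemma derive_gradient (R : realType) (d : nat) (f : 'rV[R]_d -> R)
    (x v : 'rV[R]_d) :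
  differentiable f x -> 'D_v f x = \sum_(i < d) v 0 i * gradient f x 0 i.
Proof.
move=> dfx; rewrite deriveE// {1}(row_sum_delta v) linear_sum.
by apply: eq_bigr => i _; rewrite linearZ mxE deriveE.
Qed.

Lemma convex_function_segment (R : realType) (d : nat) (g : 'rV[R]_d -> R)
    (x h : 'rV[R]_d) (t : R) :
  @convex_function R 'rV[R]_d setT g -> 0 <= t -> t <= 1 ->
  g (x + t *: h) <= (1 - t) * g x + t * g (x + h).
Proof.
move=> cvx t0 t1.
(* [conv] puts the weight [t] on its first argument, so [x + h] comes first. *)
have := cvx (Itv01 t0 t1) (x + h) x (in_setT _) (in_setT _).
have -> : conv (Itv01 t0 t1) (x + h : convex_lmodType _) x = x + t *: h.
  by rewrite /conv/= scalerDr addrAC -scalerDl unstable.add_onemK scale1r.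
by rewrite convRE/= [leRHS]addrC.
Qed.

Lemma concavifier_quadratic_bound (R : realType) (d : nat)
    (f : 'rV[R]_d -> R) (alpha : R) (x h : 'rV[R]_d) :
  concavifier f alpha -> derivable f x h ->
  f (x + h) <= f x + 'D_h f x + alpha / 2 * enorm h ^+ 2.
Proof.
move=> [alpha0 cvx] dfx.
suff : f (x + h) - f x - alpha / 2 * enorm h ^+ 2 <= 'D_h f x by lra.
(* Convexity on the segment from [x] to [x + h] only controls positive [t], so the limit is taken
   from the right. *)
apply: (cvgr_to_ge (cvg_dnbhs_at_right dfx)).
near=> t.
have t0 : 0 < t by near: t; exact: nbhs_right_gt.
have t1 : t < 1 by near: t; exact: nbhs_right_lt.
have := convex_function_segment x h cvx (ltW t0) (ltW t1).
rewrite enorm_sqrDZ /= [_ *: (_ - _)]mulrC ler_pdivlMr// [t *: h + x]addrC.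
(* Replacing [t * (1 - t)] by [t] in the defect costs half of this nonnegative term. *)
have := mulr_ge0 (ltW alpha0) (mulr_ge0 (sqr_ge0 t) (sqr_ge0 (enorm h))).
nra.
Unshelve. all: by end_near. Qed.

Lemma gradient_step_decrease (R : realType) (d : nat) (f : 'rV[R]_d -> R)
    (alpha eta : R) (x : 'rV[R]_d) :
  concavifier f alpha -> differentiable f x ->
  f (x - eta *: gradient f x) <=
  f x - decrease_coef alpha eta * enorm (gradient f x) ^+ 2.
Proof.
move=> fc fx.
have := concavifier_quadratic_bound fc
  (diff_derivable (v := - (eta *: gradient f x)) fx).
rewrite derive_gradient// -scaleNr enorm_sqrZ.
have -> : \sum_(i < d) (- eta *: gradient f x) 0 i * gradient f x 0 i =
    - eta * enorm (gradient f x) ^+ 2.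
  rewrite enorm_sqr mulr_sumr; apply: eq_bigr => i _.
  by rewrite mxE -mulrA expr2.
move=> /le_trans; apply; rewrite /decrease_coef le_eqVlt; apply/orP; left.
by apply/eqP; field.
Qed.

Lemma decrease_coefE (R : realType) (alpha eta : R) : alpha != 0 ->
  decrease_coef alpha eta =
  1 / (2 * alpha) - alpha / 2 * (eta - 1 / alpha) ^+ 2.
Proof. by move=> alpha0; rewrite /decrease_coef; field. Qed.

Lemma decrease_coef_le (R : realType) (a b eta : R) :
  0 <= eta -> a <= b -> decrease_coef b eta <= decrease_coef a eta.
Proof.
move=> eta0 ab; rewrite /decrease_coef ler_wpM2r// lerD2l lerN2.
by rewrite ler_wpM2r// ler_wpM2r.
Qed.

Lemma decrease_coef_le_max (R : realType) (alpha eta : R) : 0 < alpha ->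
  decrease_coef alpha eta <= decrease_coef alpha (1 / alpha).
Proof.
move=> alpha0; rewrite !decrease_coefE ?gt_eqF// subrr expr0n mulr0 subr0.
by rewrite gerBl mulr_ge0 ?sqr_ge0 ?divr_ge0// ltW.
Qed.

Lemma decrease_coef_max_uniq (R : realType) (alpha eta : R) : 0 < alpha ->
  decrease_coef alpha (1 / alpha) <= decrease_coef alpha eta ->
  eta = 1 / alpha.
Proof.
move=> alpha0; rewrite !decrease_coefE ?gt_eqF// subrr expr0n mulr0 subr0.
rewrite lerBrDl gerDr pmulr_rle0 ?divr_gt0// => sq_le0.
by apply/eqP; rewrite -subr_eq0 -sqrf_eq0 eq_le sq_le0 sqr_ge0.
Qed.

Theorem theorem3p2 (R : realType) (d : nat) (f : 'rV[R]_d -> R) (alpha : R)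
    (f_diff : forall x : 'rV[R]_d, differentiable f x)
    (f_conc : concavifier f alpha) :
  (forall (eta : R) (x : nat -> 'rV[R]_d),
     0 < eta -> eta <= 1 / alpha -> gradient_descent f eta x ->
     forall t : nat,
       f (x t.+1) <= f (x t) - eta / 2 * enorm (gradient f (x t)) ^+ 2) /\
  (forall astar : R, optimal_concavifier f astar ->
     forall eta : R, optimal_step_size f eta <-> eta = 1 / astar).
Proof.
have alpha0 : 0 < alpha by case: f_conc.
split=> [eta x eta0 eta_le gd t|astar [fc lb] eta].
  rewrite gd (le_trans (gradient_step_decrease eta f_conc (f_diff (x t))))//.
  (* Since [alpha * eta <= 1], the factor [1 - alpha * eta / 2] is at least 1/2. *)
  rewrite lerD2l lerN2 ler_wpM2r ?sqr_ge0// /decrease_coef mulrC ler_wpM2r//.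
    exact: ltW.
  by move: eta_le; rewrite ler_pdivlMr//; lra.
have astar0 : 0 < astar by case: fc.
split=> [[eta0 [a fa opt]]|->].
  apply: decrease_coef_max_uniq => //.
  (* Test optimality against the pair [1 / astar], [astar]; then lowering [a] to [astar] can only
     raise the coefficient at [eta]. *)
  apply: (le_trans (opt _ _ _ fc)); first by rewrite divr_gt0.
  by apply: decrease_coef_le; [exact: ltW|exact: lb].
split; first by rewrite divr_gt0.
exists astar => // eta' alpha' eta'0 fa'.
(* First lower [alpha'] to [astar] at fixed [eta'], then move [eta'] to the vertex [1 / astar]. *)
apply: le_trans (decrease_coef_le_max eta' astar0).
by apply: decrease_coef_le; [exact: ltW|exact: lb].
Qed.
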